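(* Let $n\geq1$. Define matrices with rows and columns indexed by subsets $S,T\subseteq[n-1]$ and entries in $\mathbb{Z}[q]$: $$A(q)_{ST}=\sum_{\substack{w\in\mathfrak{S}_n\\ \overline{S}\subseteq C(w),\ T\subseteq D(w)}} q^{\mathrm{inv}(w)},\quad B(q)_{ST}=\sum_{\substack{w\in\mathfrak{S}_n\\ \overline{S}\subseteq C(w),\ T= D(w)}} q^{\mathrm{inv}(w)},\quad \Gamma(q)_{ST}=\sum_{\substack{w\in\mathfrak{S}_n\\ C(w)=\overline{S},\ D(w)=T}} q^{\mathrm{inv}(w)}.$$ Then these matrices are invertible and $$A(q)^{-1}_{ST}=(-1)^{\#S+\#T}A(1/q)_{ST},\qquad B(q)^{-1}_{ST}=(-1)^{\#S+\#T}\sum_{\substack{w\in\mathfrak{S}_n\\ \overline{S}=C(w),\ T\subseteq D(w)}} q^{-\mathrm{inv}(w)},\qquad \Gamma(q)^{-1}_{ST}=(-1)^{\#S+\#T}\Gamma(1/q)_{ST},$$ where $N^{-1}_{ST}$ denotes the $(S,T)$-entry of $N^{-1}$.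
   Context: $[n]=\{1,\dots,n\}$, $\mathfrak{S}_n$ is the set of permutations $w=a_1\cdots a_n$ of $[n]$; $\mathrm{inv}(w)=\#\{(i,j): i<j,\ a_i>a_j\}$. For $X\subseteq[n-1]$, $\overline{X}=[n-1]\setminus X$. $D(w)=\{i : a_i>a_{i+1}\}$ and $C(w)=\{i\in[n-1] : a_j<a_k \text{ for all } j\leq i<k\}$. *)

(* Defs.v *)
From mathcomp Require Import all_boot all_order all_algebra all_fingroup.
Set Implicit Arguments.
Unset Strict Implicit.
Unset Printing Implicit Defensive.
Import GRing.Theory.
Local Open Scope ring_scope.

(* Indices are shifted down by one: positions and letters 1, ..., n are 'I_n,
   and i : 'I_n.-1 stands for the element i + 1 of [n-1].  Thus i itself names
   the (i+1)-st position, and i.+1 the next one. *)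

Definition cur_pos n (i : 'I_n.-1) : 'I_n := widen_ord (leq_pred n) i.

Lemma next_pos_subproof n (i : 'I_n.-1) : (i.+1 < n)%N.
Proof. by rewrite -ltn_predRL. Qed.

Definition next_pos n (i : 'I_n.-1) : 'I_n := Ordinal (next_pos_subproof i).

Definition inv_count n (w : 'S_n) : nat :=
  #|[set p : 'I_n * 'I_n | (p.1 < p.2)%N && (w p.2 < w p.1)%N]|.

Definition descent_set n (w : 'S_n) : {set 'I_n.-1} :=
  [set i | (w (next_pos i) < w (cur_pos i))%N].

Definition connectivity_set n (w : 'S_n) : {set 'I_n.-1} :=
  [set i : 'I_n.-1 | [forall j : 'I_n, forall k : 'I_n,
     (j <= i < k)%N ==> (w j < w k)%N]].

Definition A_entry n (S T : {set 'I_n.-1}) : {poly int} :=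
  \sum_(w : 'S_n | (~: S \subset connectivity_set w) && (T \subset descent_set w))
     'X^(inv_count w).

Definition B_entry n (S T : {set 'I_n.-1}) : {poly int} :=
  \sum_(w : 'S_n | (~: S \subset connectivity_set w) && (T == descent_set w)) 'X^(inv_count w).

Definition Gamma_entry n (S T : {set 'I_n.-1}) : {poly int} :=
  \sum_(w : 'S_n | (connectivity_set w == ~: S) && (descent_set w == T)) 'X^(inv_count w).

(* Matrices with rows and columns indexed by the subsets of [n-1], through the
   enumeration of {set 'I_n.-1}. *)
Definition subset_mx (R : Type) n (f : {set 'I_n.-1} -> {set 'I_n.-1} -> R) :
    'M[R]_#|{set 'I_n.-1}| :=
  \matrix_(i, j) f (enum_val i) (enum_val j).

Definition subset_entry (R : Type) n (M : 'M[R]_#|{set 'I_n.-1}|)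
    (S T : {set 'I_n.-1}) : R :=
  M (enum_rank S) (enum_rank T).

Definition A_mx n : 'M[{poly int}]_#|{set 'I_n.-1}| := subset_mx (@A_entry n).
Definition B_mx n : 'M[{poly int}]_#|{set 'I_n.-1}| := subset_mx (@B_entry n).
Definition Gamma_mx n : 'M[{poly int}]_#|{set 'I_n.-1}| :=
  subset_mx (@Gamma_entry n).

(* The matrices are inverted over Q(q), the fraction field of Z[q]: det A(q),
   a power of q up to sign, is in general not a unit of Z[q]. *)
Definition Qq_var : {fraction {poly int}} := tofrac 'X.

Definition over_Qq m (M : 'M[{poly int}]_m) : 'M[{fraction {poly int}}]_m :=
  map_mx (fun p => tofrac p) M.

Definition at_q_inv (p : {poly int}) : {fraction {poly int}} :=
  (map_poly intr p).[Qq_var^-1].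

(* Main.v *)
(* Let W_T be the group of permutations preserving the blocks cut out by the
   complement of T, i.e. those w with ~: T contained in C(w).  Every x is
   uniquely v \o w with w in W_T and v decreasing on the blocks of T, and then
   inv v = inv x + inv w.  Hence A(1/q)_{ST} A(q)_{TU} is, for U <= T <= S, the
   sum of q^(- inv x) over the x in W_S without descents in U, which does not
   depend on T, and vanishes otherwise.  The alternating sum over T is zero
   unless S = U, when only x = 1 remains.  The other two inverses follow from
   A = Z Gamma Z and B = Z Gamma, with Z the zeta matrix of inclusion. *)

Require Import Defs.
From mathcomp Require Import all_boot all_order all_algebra all_fingroup.
From mathcomp Require Import zify.
Import GRing.Theory.
Local Open Scope ring_scope.

(** * Block-preserving permutations *)

Section Parabolic.
Context {n : nat}.
Implicit Types (S T U : {set 'I_n.-1}) (v w x : 'S_n) (i j : 'I_n).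

(** Each [k] outside [T] is a cut between the positions [k] and [k.+1]; the blocks are the maximal
    runs of positions that no cut separates. *)
Definition same_block T i j :=
  [forall k : 'I_n.-1, (k \notin T) ==> ((i <= k)%N == (j <= k)%N)].

Lemma same_blockP T i j :
  reflect (forall k : 'I_n.-1, k \notin T -> (i <= k)%N = (j <= k)%N)
          (same_block T i j).
Proof.
by apply: (iffP forallP) => h k; [move=> /(implyP (h k))/eqP | apply/implyP => /h ->].
Qed.

(** Membership in [C(w)] becomes preservation of the initial segment ending at [k], a condition
    visibly stable under products and inverses. *)
Lemma connectivityP w (k : 'I_n.-1) :
  reflect (forall i, (w i <= k)%N = (i <= k)%N) (k \in connectivity_set w).
Proof.
rewrite inE; apply: (iffP idP) => [/forallP hC | hw]; last first.
  apply/forallP => i; apply/forallP => j; apply/implyP => /andP[ik kj].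
  have := hw i; have := hw j; lia.
have {}hC i j : (i <= k < j)%N -> (w i < w j)%N.
  by move=> ikj; have /forallP/(_ j)/implyP/(_ ikj) := hC i.
pose A := [set i : 'I_n | (i <= k)%N].
(* By equal cardinality, either inclusion between [A] and its preimage suffices. If some [i] in [A]
   is sent beyond [k], no [j] beyond [k] can be sent into [A], because [w i < w j]. *)
have cA : #|w @^-1: A| = #|A| by apply: card_preimset; exact: perm_inj.
suff /setP eA : w @^-1: A = A by move=> i; have := eA i; rewrite !inE.
have [sA | /subsetPn[i iA wiA]] := boolP (A \subset w @^-1: A).
  by apply/esym/eqP; rewrite eqEcard sA cA leqnn.
apply/eqP; rewrite eqEcard cA leqnn andbT; apply/subsetP => j.
move: iA wiA; rewrite !inE => ik wik wjk.
by case: leqP => // kj; have := hC i j; lia.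
Qed.

Definition parabolic T w := ~: T \subset connectivity_set w.

Lemma parabolicP T w :
  reflect (forall (k : 'I_n.-1) i, k \notin T -> (w i <= k)%N = (i <= k)%N)
          (parabolic T w).
Proof.
apply: (iffP subsetP) => [h k i kT | h k].
  by apply/connectivityP/h; rewrite inE.
by rewrite inE => kT; apply/connectivityP => i; apply: h.
Qed.

Lemma parabolicM T v w : parabolic T v -> parabolic T w -> parabolic T (v * w)%g.
Proof.
by move=> /parabolicP hv /parabolicP hw; apply/parabolicP => k i kT; rewrite permM hw ?hv.
Qed.

Lemma parabolicV T w : parabolic T w -> parabolic T w^-1%g.
Proof.
move=> /parabolicP hw; apply/parabolicP => k i kT.
by rewrite -[in RHS](permKV w i) hw.
Qed.

Lemma parabolicS S T w : S \subset T -> parabolic S w -> parabolic T w.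
Proof. by rewrite -setCS /parabolic; apply: subset_trans. Qed.

Lemma parabolic1 T : parabolic T 1%g.
Proof. by apply/parabolicP => k i; rewrite perm1. Qed.

Lemma same_block_parabolic T w i j :
  parabolic T w -> same_block T (w i) (w j) = same_block T i j.
Proof.
move=> /parabolicP hw.
by apply/same_blockP/same_blockP => h k kT; have := h k kT; rewrite !hw.
Qed.

(** A cut between [i] and [j] also lies between their images, with the same one on its left. *)
Lemma parabolic_lt T w i j :
  parabolic T w -> ~~ same_block T i j -> (w i < w j)%N = (i < j)%N.
Proof.
move=> /parabolicP hw /forallPn[k]; rewrite negb_imply => /andP[kT].
have := hw k i kT; have := hw k j kT; lia.
Qed.

(** * Descents and inversions relative to the blocks *)

Lemma connected_not_descent w k : k \in connectivity_set w -> k \notin descent_set w.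
Proof.
move/connectivityP => h; rewrite inE -leqNgt.
have := h (cur_pos k); have := h (next_pos k) => /=; lia.
Qed.

Lemma same_block_next T k : k \in T -> same_block T (cur_pos k) (next_pos k).
Proof.
move=> kT; apply/same_blockP => l lT /=.
have : k != l by apply: contraNneq lT => <-.
rewrite -val_eqE /=; lia.
Qed.

Lemma descents_decreasing T v i j :
  T \subset descent_set v -> same_block T i j -> (i < j)%N -> (v j < v i)%N.
Proof.
move=> /subsetP hv; case: j => j; elim: j => [//|j IH] hj /same_blockP hb /= ij.
have hj' : (j < n.-1)%N by lia.
pose k := Ordinal hj'.
have kT : k \in T.
  by apply/negPn/negP => kT; have := hb k kT; rewrite /=; lia.
have := hv k kT; rewrite inE.
have -> : next_pos k = Ordinal hj by apply: val_inj.
move=> lt1; have [eij|neij] := eqVneq (i : nat) j.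
  suff <- : cur_pos k = i by [].
  by apply: val_inj; rewrite /= eij.
have jn : (j < n)%N by lia.
have ek : cur_pos k = Ordinal jn by apply: val_inj.
apply: (ltn_trans lt1); rewrite ek; apply: IH => //=; last by lia.
apply/same_blockP => l lT; rewrite (hb l lT) /=.
have := hb l lT; have : k != l by apply: contraNneq lT => <-.
rewrite -val_eqE /=; lia.
Qed.

Lemma same_block_sym T i j : same_block T i j = same_block T j i.
Proof. by apply/same_blockP/same_blockP => h k kT; rewrite h. Qed.

Lemma descents_ltE T v i j :
  T \subset descent_set v -> same_block T i j -> (v i < v j)%N = (j < i)%N.
Proof.
move=> hv hb; have [lt1|lt1|/val_inj->] := ltngtP j i; last by rewrite ltnn.
  by apply: descents_decreasing hv _ lt1; rewrite same_block_sym.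
have := descents_decreasing _ _ _ _ hv hb lt1.
by rewrite ltnNge leq_eqVlt negb_or => /andP[_ /negbTE].
Qed.

Lemma perm_leqNlt w i j : i != j -> (w i <= w j)%N = (w i < w j)%N.
Proof. by move=> nij; rewrite [RHS]ltn_neqAle val_eqE (inj_eq perm_inj) nij. Qed.

Lemma descent_set_eq0 w : descent_set w = set0 -> w = 1%g.
Proof.
move=> dw.
have inc i j : (i < j)%N -> (w i < w j)%N.
  case: j => j; elim: j => [//|j IH] hj /= ij.
  have hj' : (j < n.-1)%N by lia.
  have jn : (j < n)%N by lia.
  have : Ordinal hj' \notin descent_set w by rewrite dw inE.
  rewrite inE -leqNgt.
  have -> : next_pos (Ordinal hj') = Ordinal hj by apply: val_inj.
  have -> : cur_pos (Ordinal hj') = Ordinal jn by apply: val_inj.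
  rewrite leq_eqVlt val_eqE (inj_eq perm_inj) -val_eqE /= => /orP[|lt1]; first by lia.
  have [eij|neij] := eqVneq (i : nat) j.
    by suff -> : i = Ordinal jn by []; apply: val_inj.
  by apply: ltn_trans lt1; apply: IH => /=; lia.
have cw (k : 'I_n.-1) : k \in connectivity_set w.
  rewrite inE; apply/forallP => i; apply/forallP => j; apply/implyP => /andP[ik kj].
  by apply: inc; lia.
apply/permP => i; rewrite perm1; apply: val_inj => /=.
have h (k : 'I_n.-1) := connectivityP _ _ (cw k) i.
have := ltn_ord (w i); have := ltn_ord i.
(* If [w i] and [i] differ, the cut at the smaller of the two separates them, although [w] preserves
   every initial segment. The smaller one is below [n.-1], so this cut exists. *)
have [lt1|lt1|//] := ltngtP (w i) i => h1 h2.
  have hk : (w i < n.-1)%N by lia.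
  by have := h (Ordinal hk); rewrite /= leqnn; lia.
have hk : (i < n.-1)%N by lia.
by have := h (Ordinal hk); rewrite /= leqnn; lia.
Qed.

(** Outside [T] the permutation respects a cut and so cannot descend there; hence it has no descent
    at all. *)
Lemma parabolic_ascents w T :
  parabolic T w -> [disjoint T & descent_set w] -> w = 1%g.
Proof.
move=> /subsetP hw dT; apply: descent_set_eq0; apply/setP => k; rewrite [RHS]inE.
have [kT|kT] := boolP (k \in T); first exact: disjointFr dT kT.
by apply/negbTE/connected_not_descent/hw; rewrite inE.
Qed.

(* [w * v] is the composite [v \o w]: since [w] permutes each block and [v] is
   decreasing there, [v] exchanges ascents and descents of [w]. *)
Lemma descent_mul T v w k :
  T \subset descent_set v -> parabolic T w -> k \in T ->
  (k \in descent_set (w * v)%g) = (k \notin descent_set w).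
Proof.
move=> hv hw kT; rewrite !inE !permM -leqNgt.
rewrite (descents_ltE T) //; last first.
  by rewrite same_block_parabolic // same_block_sym same_block_next.
by rewrite perm_leqNlt // -val_eqE /= ltn_eqF.
Qed.

(** Inside blocks, [v] inverts every pair and [w * v] exactly those that [w] does not. Across
    blocks, [w] inverts nothing, and [v] and [w * v] have equally many inversions. *)
Lemma inv_count_mul T v w :
  T \subset descent_set v -> parabolic T w ->
  inv_count v = (inv_count (w * v)%g + inv_count w)%N.
Proof.
move=> hv hw; rewrite /inv_count.
set I := fun w : 'S_n => [set p : 'I_n * 'I_n | (p.1 < p.2)%N && (w p.2 < w p.1)%N].
pose K := [set p : 'I_n * 'I_n | same_block T p.1 p.2].
pose P := [set p in K | (p.1 < p.2)%N].
have eqv : I v :&: K = P.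
  apply/setP => p; rewrite !inE andbC.
  case hb: same_block => //=; case: ltnP => //= lt1.
  exact: descents_decreasing hv hb lt1.
have subw : I w \subset P.
  apply/subsetP => p; rewrite !inE => /andP[lt1 lt2]; rewrite lt1 andbT.
  by case: (boolP (same_block _ _ _)) => // /(parabolic_lt _ _ _ _ hw); lia.
have eqwv : I (w * v)%g :&: K = P :\: I w.
  apply/setP => p; rewrite !inE !permM andbC.
  case hb: same_block; rewrite ?andbF //=; case: ltnP => //= lt1; rewrite andbT -leqNgt.
  rewrite (descents_ltE T) ?perm_leqNlt //; last first.
    by rewrite same_block_parabolic // same_block_sym.
  by rewrite -val_eqE ltn_eqF.
(* Applying [w] to both coordinates keeps the order of a pair from different blocks, so it matches
   the inversions of [w * v] with those of [v]. *)
have eqD : #|I (w * v)%g :\: K| = #|I v :\: K|.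
  pose f (p : 'I_n * 'I_n) := (w p.1, w p.2).
  have f_inj : injective f by case=> a b [c d] [] /perm_inj -> /perm_inj ->.
  rewrite -(card_preimset (I v :\: K) f_inj); apply: eq_card => p.
  rewrite !inE !permM /= same_block_parabolic //.
  by case: (boolP (same_block _ _ _)) => //= /(parabolic_lt _ _ _ _ hw) ->.
rewrite -(cardsID K (I v)) -(cardsID K (I (w * v)%g)) eqv eqwv eqD.
by rewrite -(cardsID (I w) P) (setIidPr subw) -addnA addnC.
Qed.

(** * Factorization along cosets of the block-preserving subgroup *)

Lemma adjacent_parabolic T k :
  k \in T -> parabolic T (tperm (cur_pos k) (next_pos k)).
Proof.
move=> kT; apply/parabolicP => l i lT.
have : k != l by apply: contraNneq lT => <-.
rewrite -val_eqE /=; case: tpermP => [->|->|//] /=; lia.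
Qed.

Lemma adjacent_inv_gt0 (k : 'I_n.-1) :
  (0 < @inv_count n (tperm (cur_pos k) (next_pos k)))%N.
Proof.
apply/card_gt0P; exists (cur_pos k, next_pos k).
by rewrite inE /= tpermL tpermR /= ltnSn.
Qed.

(* A longest element of the coset [x W_T] descends at all positions of [T]. *)
Lemma parabolic_factorization T x :
  exists p : 'S_n * 'S_n,
    [/\ T \subset descent_set p.1, parabolic T p.2 & (p.2 * p.1)%g = x].
Proof.
case: (@arg_maxnP _ 1%g (parabolic T) (fun u => inv_count (u * x)%g)) => [|u hu umax].
  exact: parabolic1.
exists ((u * x)%g, u^-1%g); split=> /=; [|exact: parabolicV|by rewrite mulKg].
apply/subsetP => k kT; apply/negPn/negP => nk.
set s := tperm (cur_pos k) (next_pos k).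
have sT : parabolic T s by apply: adjacent_parabolic.
(* The inversion formula is used for the smaller set [[set k]]: an ascent of [u * x] at [k] is a
   descent of [s * (u * x)], which is therefore strictly longer and contradicts maximality. *)
have sk : parabolic [set k] s by apply: adjacent_parabolic; rewrite inE.
have Dk : [set k] \subset descent_set (s * (u * x))%g.
  rewrite sub1set inE !(permM s) tpermL tpermR.
  by move: nk; rewrite inE -leqNgt perm_leqNlt // -val_eqE /= ltn_eqF.
have := umax _ (parabolicM _ _ _ sT hu); rewrite -(mulgA s u x) /=.
rewrite (inv_count_mul _ _ _ Dk sk) (mulgA s s) tperm2 mul1g /geq /=.
by rewrite leqNgt -addn1 leq_add2l adjacent_inv_gt0.
Qed.

(** Both [v] and [v' = (w'^-1 * w) * v] descend on all of [T], so the block-preserving [w'^-1 * w]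
    ascends there and must be the identity. *)
Lemma parabolic_factorization_uniq T v w v' w' :
  T \subset descent_set v -> parabolic T w ->
  T \subset descent_set v' -> parabolic T w' ->
  (w * v = w' * v')%g -> v = v' /\ w = w'.
Proof.
move=> hv hw hv' hw' e.
have hu : parabolic T (w'^-1 * w)%g by apply: parabolicM => //; exact: parabolicV.
have ev : v' = ((w'^-1 * w) * v)%g by rewrite -mulgA e mulKg.
suff u1 : (w'^-1 * w)%g = 1%g.
  by rewrite ev u1 mul1g; split => //; rewrite -[w](mulKVg w') u1 mulg1.
apply: (parabolic_ascents _ T) => //; rewrite disjoint_subset; apply/subsetP => k kT.
by rewrite inE -(descent_mul _ _ _ _ hv hu kT) -ev (subsetP hv').
Qed.

End Parabolic.

(** * Alternating sums over intervals of subsets *)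

Lemma alternating_interval_sum (R : pzRingType) (I : finType) (S U : {set I}) :
  \sum_(T : {set I} | (U \subset T) && (T \subset S)) (-1) ^+ (#|S| + #|T|)
    = (S == U)%:R :> R.
Proof.
have [->|neSU] := eqVneq S U.
  rewrite (big_pred1 U) => [|T]; last by rewrite -eqEsubset eq_sym.
  by rewrite addnn -signr_odd odd_double.
have [sUS|nUS] := boolP (U \subset S); last first.
  rewrite big_pred0 // => T; apply: contraNF nUS => /andP[].
  exact: subset_trans.
have /subsetPn[a aS aU] : ~~ (S \subset U).
  by apply: contraNN neSU => sSU; rewrite eqEsubset sSU sUS.
(* Adding or removing [a], which lies in [S] but not in [U], pairs the terms of the interval with
   opposite signs. *)
rewrite (bigID (fun T : {set I} => a \in T)) /=.
rewrite (reindex_onto (fun T => a |: T) (fun T => T :\ a)) /=; last first.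
  by move=> T /andP[_ aT]; rewrite setD1K.
rewrite [X in X + _](eq_bigl (fun T : {set I} => (U \subset T) && (T \subset S) && (a \notin T))).
  rewrite -big_split big1 // => T /andP[_ aT].
  by rewrite cardsU1 aT addnCA add1n exprS mulN1r; exact: addNr.
move=> T; rewrite setU11 andbT; have [aT|aT] := boolP (a \in T).
  rewrite !andbF; apply/negbTE; rewrite negb_and; apply/orP; right.
  by apply: contraTneq aT => <-; rewrite !inE eqxx.
rewrite setU1K // eqxx !andbT subUset sub1set aS /=; congr (_ && _).
by rewrite -[in RHS](setU1K aT) subsetD1 aU andbT.
Qed.

(** * Entries over a field and the inverse of [A] *)

Section Matrices.
Context {n : nat} {F : fieldType}.
Implicit Types (S T U : {set 'I_n.-1}) (p q : F).

(** The parameter is an arbitrary field element, so that [q] and [q^-1] are values of one family. *)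
Definition A_at p S T : F :=
  \sum_(w : 'S_n | (~: S \subset connectivity_set w) && (T \subset descent_set w))
     p ^+ inv_count w.

Definition B_at p S T : F :=
  \sum_(w : 'S_n | (~: S \subset connectivity_set w) && (T == descent_set w))
     p ^+ inv_count w.

Definition B_dual_at p S T : F :=
  \sum_(w : 'S_n | (~: S == connectivity_set w) && (T \subset descent_set w))
     p ^+ inv_count w.

Definition Gamma_at p S T : F :=
  \sum_(w : 'S_n | (connectivity_set w == ~: S) && (descent_set w == T))
     p ^+ inv_count w.

(** A position in [T] but not in [S] would have to be both a respected cut and a descent. *)
Lemma A_at_eq0 p S T : ~~ (T \subset S) -> A_at p S T = 0.
Proof.
move=> /subsetPn[k kT kS]; rewrite /A_at big_pred0 // => w.
apply/negP => /andP[/subsetP/(_ k) cw /subsetP/(_ k kT) dw].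
by have := connected_not_descent w k; rewrite dw cw ?inE // => /(_ isT).
Qed.

Lemma A_at_mul q S T U : q != 0 -> U \subset T -> T \subset S ->
  A_at q^-1 S T * A_at q T U
    = \sum_(x : 'S_n | parabolic S x && [disjoint U & descent_set x])
        q^-1 ^+ inv_count x.
Proof.
move=> q0 sUT sTS.
have [h hP] := fin_all_exists (parabolic_factorization T).
rewrite /A_at big_distrlr pair_big_dep /=.
(* The pairs [(v, w)] of the double sum are indexed by their product [x]; uniqueness of the
   factorization makes the chosen [h] inverse to multiplication. *)
rewrite (reindex_onto h (fun vw => vw.2 * vw.1)%g) /=; last first.
  move=> [v w] /= /andP[/andP[_ Dv] /andP[Cw _]].
  have [Dv' Cw' e] := hP (w * v)%g.
  have [e1 e2] := parabolic_factorization_uniq _ _ _ _ _ Dv' Cw' Dv Cw e.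
  by rewrite [LHS]surjective_pairing e1 e2.
apply: eq_big => x; have [Dv Cw e] := hP x.
  rewrite Dv andbT [X in _ && (X && _)]Cw e eqxx andbT; congr (_ && _).
    (* As [T] is contained in [S], the factor [w] also preserves the blocks of [S], so [v] does
       exactly when [x] does. *)
    rewrite -/(parabolic S (h x).1) -[in RHS]e.
    have Cw' : parabolic S (h x).2 by apply: parabolicS Cw.
    apply/idP/idP => [Cv|Cx]; first exact: parabolicM.
    by rewrite -(mulKg (h x).2 (h x).1) parabolicM // parabolicV.
  have DU k : k \in U -> (k \in descent_set (h x).2) = (k \notin descent_set x).
    by move=> kU; rewrite -[in RHS]e (descent_mul _ _ _ _ Dv Cw) ?negbK ?(subsetP sUT).
  rewrite disjoint_subset; apply/subsetP/subsetP => sU k kU.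
    by rewrite inE /= -DU ?sU.
  by rewrite DU ?sU //; have := sU k kU; rewrite inE.
move=> _; rewrite (inv_count_mul _ _ _ Dv Cw) e exprD -mulrA -exprMn mulVf //.
by rewrite expr1n mulr1.
Qed.

Lemma A_at_inverse q S U : q != 0 ->
  \sum_(T : {set 'I_n.-1}) (-1) ^+ (#|S| + #|T|) * A_at q^-1 S T * A_at q T U = (S == U)%:R.
Proof.
move=> q0.
rewrite (bigID (fun T => (U \subset T) && (T \subset S))) /= [X in _ + X]big1 ?addr0.
  under eq_bigr => T /andP[sUT sTS] do rewrite -mulrA A_at_mul //.
  rewrite -big_distrl alternating_interval_sum /=.
  have [<-|_] := eqVneq S U; last by rewrite mul0r.
  rewrite /= mul1r (big_pred1 1%g).
    suff -> : @inv_count n 1%g = 0%N by [].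
    apply/eqP; rewrite cards_eq0; apply/eqP/setP => p; rewrite !inE !perm1.
    by case: ltngtP.
  move=> x; apply/andP/eqP => [[Cx Dx]|->]; first exact: parabolic_ascents Cx Dx.
  split; first exact: parabolic1.
  rewrite disjoint_subset; apply/subsetP => k _.
  by rewrite !inE !perm1 -leqNgt /= leqnSn.
by move=> T; rewrite negb_and => /orP[] /A_at_eq0 ->; rewrite ?mulr0 ?mul0r.
Qed.

(** * Zeta factorizations and the inverses of [B] and [Gamma] *)

Lemma subset_mxM (f g : {set 'I_n.-1} -> {set 'I_n.-1} -> F) :
  subset_mx f *m subset_mx g = subset_mx (fun S T : {set 'I_n.-1} => \sum_U f S U * g U T).
Proof.
apply/matrixP => i j; rewrite !mxE [RHS](reindex_onto enum_val enum_rank) /=.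
  by apply: eq_big => [k|k _]; rewrite ?mxE // enum_valK eqxx.
by move=> U _; rewrite enum_rankK.
Qed.

Lemma eq_subset_mx (f g : {set 'I_n.-1} -> {set 'I_n.-1} -> F) :
  (forall S T, f S T = g S T) -> subset_mx f = subset_mx g.
Proof. by move=> fg; apply/matrixP => i j; rewrite !mxE. Qed.

Lemma subset_mx1 : subset_mx (fun S T : {set 'I_n.-1} => (S == T)%:R : F) = 1%:M.
Proof. by apply/matrixP => i j; rewrite !mxE (inj_eq enum_val_inj). Qed.

Definition zeta := subset_mx (fun S T : {set 'I_n.-1} => (T \subset S)%:R : F).

Definition signed (f : {set 'I_n.-1} -> {set 'I_n.-1} -> F) :=
  subset_mx (fun S T : {set 'I_n.-1} => (-1) ^+ (#|S| + #|T|) * f S T).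

(** Signing is conjugation by the diagonal matrix of the signs [(-1) ^+ #|S|], hence multiplicative:
    the intermediate sign occurs twice. *)
Lemma signedM f g :
  signed f *m signed g = signed (fun S T => \sum_U f S U * g U T).
Proof.
rewrite subset_mxM; apply: eq_subset_mx => S T; rewrite big_distrr /=.
apply: eq_bigr => U _; rewrite mulrACA -exprD addnA -(addnA #|S|) addnn addnAC.
by rewrite exprD -[_ ^+ _.*2]signr_odd odd_double mulr1.
Qed.

Lemma B_at_Gamma p S T : B_at p S T = \sum_(U : {set 'I_n.-1}) (U \subset S)%:R * Gamma_at p U T.
Proof.
rewrite /B_at (partition_big (fun w => ~: connectivity_set w)
                 (fun U => U \subset S)) /=.
  rewrite big_mkcond /=; apply: eq_bigr => U _.
  case: ifP => [sUS|_]; last by rewrite mul0r.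
  rewrite mul1r; apply: eq_bigl => w.
  rewrite -(inj_eq (@setC_inj _) _ (~: U)) setCK subCset (eq_sym T).
  by have [->|] := eqVneq (~: connectivity_set w) U; rewrite ?andbF ?sUS ?andbT.
by move=> w /andP[]; rewrite subCset.
Qed.

Lemma B_dual_at_Gamma p S T :
  B_dual_at p S T = \sum_(U : {set 'I_n.-1}) Gamma_at p S U * (T \subset U)%:R.
Proof.
rewrite /B_dual_at (partition_big (@descent_set n) (fun U => T \subset U)) /=.
  rewrite big_mkcond /=; apply: eq_bigr => U _.
  case: ifP => [sTU|_]; last by rewrite mulr0.
  rewrite mulr1; apply: eq_bigl => w; rewrite eq_sym.
  by have [->|] := eqVneq (descent_set w) U; rewrite ?andbF ?andbT ?sTU ?andbT.
by move=> w /andP[].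
Qed.

Lemma A_at_B p S T :
  A_at p S T = \sum_(U : {set 'I_n.-1}) B_at p S U * (T \subset U)%:R.
Proof.
rewrite /A_at (partition_big (@descent_set n) (fun U => T \subset U)) /=.
  rewrite big_mkcond /=; apply: eq_bigr => U _.
  case: ifP => [sTU|_]; last by rewrite mulr0.
  rewrite mulr1; apply: eq_bigl => w; rewrite (eq_sym U).
  by have [->|] := eqVneq (descent_set w) U; rewrite ?andbF ?andbT ?sTU ?andbT.
by move=> w /andP[].
Qed.

Lemma A_at_B_dual p S T :
  A_at p S T = \sum_(U : {set 'I_n.-1}) (U \subset S)%:R * B_dual_at p U T.
Proof.
rewrite A_at_B; under eq_bigr => U _ do rewrite B_at_Gamma mulr_suml.
rewrite exchange_big; apply: eq_bigr => V _; rewrite B_dual_at_Gamma mulr_sumr.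
by apply: eq_bigr => U _; rewrite mulrA.
Qed.

(** This is Möbius inversion on the lattice of subsets. *)
Lemma signed_zetaK : signed (fun S T => (T \subset S)%:R) *m zeta = 1%:M.
Proof.
rewrite subset_mxM -subset_mx1; apply: eq_subset_mx => S T.
rewrite -alternating_interval_sum [RHS]big_mkcond; apply: eq_bigr => U _.
by rewrite -mulrA -natrM mulnb andbC; case: ifP; rewrite ?mulr1 ?mulr0.
Qed.

Lemma signed_A_at_inverse q :
  q != 0 -> signed (A_at q^-1) *m subset_mx (A_at q) = 1%:M.
Proof.
move=> q0; rewrite subset_mxM -subset_mx1.
by apply: eq_subset_mx => S T; apply: A_at_inverse.
Qed.

Lemma signed_B_dual_at_inverse q :
  q != 0 -> signed (B_dual_at q^-1) *m subset_mx (B_at q) = 1%:M.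
Proof.
move=> q0; have := signed_A_at_inverse _ q0.
have -> : signed (A_at q^-1)
    = signed (fun S T => (T \subset S)%:R) *m signed (B_dual_at q^-1).
  by rewrite signedM; apply: eq_subset_mx => S T; rewrite A_at_B_dual.
have -> : subset_mx (A_at q) = subset_mx (B_at q) *m zeta.
  by rewrite subset_mxM; apply: eq_subset_mx => S T; rewrite A_at_B.
(* One-sided inverses of square matrices commute, so the signed zeta factor moves from the left end
   to the right end, where it cancels [zeta]. *)
rewrite -mulmxA => /mulmx1C; rewrite !mulmxA -(mulmxA _ zeta).
by rewrite (mulmx1C signed_zetaK) mulmx1.
Qed.

(** In the identity for [B], the signed zeta factor of [B_dual_at] meets the zeta factor of [B_at]
    in the middle and cancels it. *)
Lemma signed_Gamma_at_inverse q :
  q != 0 -> signed (Gamma_at q^-1) *m subset_mx (Gamma_at q) = 1%:M.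
Proof.
move=> q0; rewrite -(signed_B_dual_at_inverse _ q0).
have -> : signed (B_dual_at q^-1)
    = signed (Gamma_at q^-1) *m signed (fun S T => (T \subset S)%:R).
  by rewrite signedM; apply: eq_subset_mx => S T; rewrite B_dual_at_Gamma.
have -> : subset_mx (B_at q) = zeta *m subset_mx (Gamma_at q).
  by rewrite subset_mxM; apply: eq_subset_mx => S T; rewrite B_at_Gamma.
by rewrite mulmxA -(mulmxA (signed _)) signed_zetaK mulmx1.
Qed.

Lemma invmx_signed f g S T :
  signed f *m subset_mx g = 1%:M ->
  subset_entry (invmx (subset_mx g)) S T = (-1) ^+ (#|S| + #|T|) * f S T.
Proof.
move=> fg; have [_ gu] := mulmx1_unit fg.
rewrite -[invmx _]mul1mx -fg mulmxK //.
by rewrite /subset_entry /signed mxE !enum_rankK.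
Qed.

End Matrices.

(** * Specialization to the fraction field of the integer polynomials *)

Lemma over_Qq_subset_mx n (f : {set 'I_n.-1} -> {set 'I_n.-1} -> {poly int}) :
  over_Qq (subset_mx f) = subset_mx (fun S T => tofrac (f S T)).
Proof. by apply/matrixP => i j; rewrite !mxE. Qed.

Lemma subset_entry_mx (R : Type) n (f : {set 'I_n.-1} -> {set 'I_n.-1} -> R) S T :
  subset_entry (subset_mx f) S T = f S T.
Proof. by rewrite /subset_entry mxE !enum_rankK. Qed.

Lemma Qq_var_neq0 : Qq_var != 0.
Proof. by rewrite tofrac_eq0 polyX_eq0. Qed.

Lemma tofrac_sumX (I : finType) (P : pred I) (e : I -> nat) :
  tofrac (\sum_(i | P i) 'X^(e i) : {poly int}) = \sum_(i | P i) Qq_var ^+ e i.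
Proof. by rewrite rmorph_sum; apply: eq_bigr => i _; rewrite rmorphXn. Qed.

Lemma at_q_inv_sumX (I : finType) (P : pred I) (e : I -> nat) :
  at_q_inv (\sum_(i | P i) 'X^(e i)) = \sum_(i | P i) Qq_var^-1 ^+ e i.
Proof.
rewrite /at_q_inv rmorph_sum horner_sum; apply: eq_bigr => i _.
by rewrite /= map_polyXn hornerXn.
Qed.

Theorem theorem2p3 (n : nat) (hn : (1 <= n)%N) :
  [/\ over_Qq (A_mx n) \in unitmx,
      over_Qq (B_mx n) \in unitmx
    & over_Qq (Gamma_mx n) \in unitmx]
  /\ forall S T : {set 'I_n.-1},
     [/\ subset_entry (invmx (over_Qq (A_mx n))) S T
           = (-1) ^+ (#|S| + #|T|) * at_q_inv (subset_entry (A_mx n) S T),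
         subset_entry (invmx (over_Qq (B_mx n))) S T
           = (-1) ^+ (#|S| + #|T|)
             * \sum_(w : 'S_n | (~: S == connectivity_set w) && (T \subset descent_set w))
                  Qq_var ^- inv_count w
       & subset_entry (invmx (over_Qq (Gamma_mx n))) S T
           = (-1) ^+ (#|S| + #|T|) * at_q_inv (subset_entry (Gamma_mx n) S T)].
Proof.
have q0 := Qq_var_neq0.
have eA : over_Qq (A_mx n) = subset_mx (A_at Qq_var).
  by rewrite over_Qq_subset_mx; apply: eq_subset_mx => S T; apply: tofrac_sumX.
have eB : over_Qq (B_mx n) = subset_mx (B_at Qq_var).
  by rewrite over_Qq_subset_mx; apply: eq_subset_mx => S T; apply: tofrac_sumX.
have eG : over_Qq (Gamma_mx n) = subset_mx (Gamma_at Qq_var).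
  by rewrite over_Qq_subset_mx; apply: eq_subset_mx => S T; apply: tofrac_sumX.
rewrite eA eB eG; split.
  have [_ uA] := mulmx1_unit (signed_A_at_inverse (n := n) _ q0).
  have [_ uB] := mulmx1_unit (signed_B_dual_at_inverse (n := n) _ q0).
  have [_ uG] := mulmx1_unit (signed_Gamma_at_inverse (n := n) _ q0).
  exact (And3 uA uB uG).
move=> S T; split.
- by rewrite (invmx_signed _ _ _ _ (signed_A_at_inverse _ q0)) /A_mx subset_entry_mx
    /A_entry at_q_inv_sumX.
- rewrite (invmx_signed _ _ _ _ (signed_B_dual_at_inverse _ q0)).
  by congr (_ * _); apply: eq_bigr => w _; rewrite exprVn.
- by rewrite (invmx_signed _ _ _ _ (signed_Gamma_at_inverse _ q0)) /Gamma_mx subset_entry_mx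
    /Gamma_entry at_q_inv_sumX.
Qed.
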